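(* Let $(\mathcal{A},\Delta,\epsilon,\Phi,\mathcal{R})$ be a quasi-triangular quasi-bialgebra over a field $k$ (with the counit-normalized unit constraints $c_l,c_r$). Then the following two statements hold. (1) Suppose $\Phi_{213}\mathcal{R}_{12}=\mathcal{R}_{12}\Phi_{123}$. Then $$(\mathrm{id}\otimes\Delta)\mathcal{R}=\Phi_{231}^{-1}\mathcal{R}_{13}\mathcal{R}_{12},\qquad (\Delta\otimes\mathrm{id})\mathcal{R}=\mathcal{R}_{13}\mathcal{R}_{23}\Phi_{123},$$ and $\mathcal{R}$ satisfies the usual Yang-Baxter equation $\mathcal{R}_{12}\mathcal{R}_{13}\mathcal{R}_{23}=\mathcal{R}_{23}\mathcal{R}_{13}\mathcal{R}_{12}$. Also $(\epsilon\otimes\mathrm{id})\mathcal{R}=c_l$, $(\mathrm{id}\otimes\epsilon)\mathcal{R}=c_l^{-1}$ and $c_r=1_{\mathcal{A}}$. (2) Suppose $\Phi_{132}\mathcal{R}_{23}=\mathcal{R}_{23}\Phi_{123}$. Then $$(\mathrm{id}\otimes\Delta)\mathcal{R}=\mathcal{R}_{13}\mathcal{R}_{12}\Phi_{123}^{-1},\qquad (\Delta\otimes\mathrm{id})\mathcal{R}=\Phi_{312}\mathcal{R}_{13}\mathcal{R}_{23},$$ and $\mathcal{R}$ satisfies the usual Yang-Baxter equation $\mathcal{R}_{12}\mathcal{R}_{13}\mathcal{R}_{23}=\mathcal{R}_{23}\mathcal{R}_{13}\mathcal{R}_{12}$. Also $(\epsilon\otimes\mathrm{id})\mathcal{R}=c_r^{-1}$,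 $(\mathrm{id}\otimes\epsilon)\mathcal{R}=c_r$ and $c_l=1_{\mathcal{A}}$.
   Context: **Quasi-bialgebra.** $k$ is a field. A quasi-bialgebra $(\mathcal{A},\Delta,\epsilon,\Phi,c_r,c_l)$ is a unital associative $k$-algebra $\mathcal{A}$ with (unital) algebra homomorphisms $\Delta:\mathcal{A}\to\mathcal{A}\otimes\mathcal{A}$ and $\epsilon:\mathcal{A}\to k$, an invertible $\Phi\in\mathcal{A}\otimes\mathcal{A}\otimes\mathcal{A}$ (associator) and invertible $c_l,c_r\in\mathcal{A}$ (unit constraints) such that: (i) $(\mathrm{id}\otimes\Delta)\Delta(a)=\Phi\,\big((\Delta\otimes\mathrm{id})\Delta(a)\big)\,\Phi^{-1}$ for all $a\in\mathcal{A}$; (ii) $\big((\mathrm{id}\otimes\mathrm{id}\otimes\Delta)\Phi\big)\big((\Delta\otimes\mathrm{id}\otimes\mathrm{id})\Phi\big)=(1\otimes\Phi)\big((\mathrm{id}\otimes\Delta\otimes\mathrm{id})\Phi\big)(\Phi\otimes1)$; (iii) $(\epsilon\otimes\mathrm{id})\Delta(a)=c_l^{-1}ac_l$ and $(\mathrm{id}\otimes\epsilon)\Delta(a)=c_r^{-1}ac_r$ for all $a\in\mathcal{A}$; (iv) $(\mathrm{id}\otimes\epsilon\otimes\mathrm{id})\Phi=c_r\otimes c_l^{-1}$. **Normalization.** It is always assumed that $\epsilon(c_l)=\epsilon(c_r)=1$; then $c_l^{-1}=(\epsilon\otimes\epsilon\otimes\mathrm{id})\Phi$ and $c_r=(\mathrm{id}\otimes\epsilon\otimes\epsilon)\Phi$,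 so the unit constraints are determined by $\Phi$ and the quasi-bialgebra is denoted $(\mathcal{A},\Delta,\epsilon,\Phi)$. **Index notation.** For $A=\sum_j a_j\otimes b_j$, $A_{ij}$ denotes the element of $\mathcal{A}^{\otimes3}$ with the first leg of $A$ in slot $i$, the second leg in slot $j$, and $1$ in the remaining slot. For $\Phi=\sum_j x_j\otimes y_j\otimes z_j$ and $\{i,j,k\}=\{1,2,3\}$, $\Phi_{ijk}$ has the first leg in slot $i$, the second in slot $j$, the third in slot $k$ (so $\Phi_{123}=\Phi$). **Quasi-triangularity.** Let $\Delta^{(op)}=\sigma\circ\Delta$ with $\sigma$ the flip. $(\mathcal{A},\Delta,\epsilon,\Phi,\mathcal{R})$ is a quasi-triangular quasi-bialgebra if $(\mathcal{A},\Delta,\epsilon,\Phi)$ is a quasi-bialgebra and $\mathcal{R}\in\mathcal{A}\otimes\mathcal{A}$ is invertible with (a) $\Delta^{(op)}(a)\mathcal{R}=\mathcal{R}\Delta(a)$ for all $a\in\mathcal{A}$; (b) $(\mathrm{id}\otimes\Delta)\mathcal{R}=\Phi_{231}^{-1}\mathcal{R}_{13}\Phi_{213}\mathcal{R}_{12}\Phi_{123}^{-1}$; (c) $(\Delta\otimes\mathrm{id})\mathcal{R}=\Phi_{312}\mathcal{R}_{13}\Phi_{132}^{-1}\mathcal{R}_{23}\Phi_{123}$. *)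

(* Defs.v *)
From HB Require Import structures.
From mathcomp Require Import all_boot all_algebra.
From mathcomp Require Import boolp classical_sets.

Set Implicit Arguments.
Unset Strict Implicit.
Unset Printing Implicit Defensive.

Import GRing.Theory.
Local Open Scope ring_scope.
Local Open Scope quotient_scope.

Reserved Notation "A ⊗ B" (at level 35, right associativity).

(* U ⊗ V is the type of formal sums of pairs (u, v), written as lists, modulo  *)
(* the congruence generated by commutativity of the sum, biadditivity and      *)
(* k-balancedness.  The negative of (u, v) is (- u, v), hence teq_zero.        *)
Section TensorType.
Context {k : fieldType}.

Inductive teq (U V : lmodType k) : seq (U * V) -> seq (U * V) -> Prop :=
| teq_refl s : teq s s
| teq_sym s t : teq s t -> teq t s
| teq_trans s t r : teq s t -> teq t r -> teq s r
| teq_cat s s' t t' : teq s s' -> teq t t' -> teq (s ++ t) (s' ++ t')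
| teq_catC s t : teq (s ++ t) (t ++ s)
| teq_addl u u' v : teq [:: (u + u', v)] [:: (u, v); (u', v)]
| teq_addr u v v' : teq [:: (u, v + v')] [:: (u, v); (u, v')]
| teq_scale c u v : teq [:: (c *: u, v)] [:: (u, c *: v)]
| teq_zero v : teq [:: (0, v)] [::].

Variables U V : lmodType k.

Definition teqb (s t : seq (U * V)) : bool := `[< teq s t >].

Lemma teqb_refl : reflexive teqb.
Proof. by move=> s; apply/asboolP; exact: teq_refl. Qed.
Lemma teqb_sym : symmetric teqb.
Proof.
by move=> s t; apply/asboolP/asboolP => /teq_sym.
Qed.
Lemma teqb_trans : transitive teqb.
Proof.
move=> t s r /asboolP st /asboolP tr; apply/asboolP; exact: teq_trans st tr.
Qed.

Canonical teq_equiv := EquivRel teqb teqb_refl teqb_sym teqb_trans.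

Definition tensor : Type := {eq_quot teq_equiv}.

HB.instance Definition _ := Choice.on tensor.

Definition tens_of (s : seq (U * V)) : tensor := \pi_({eq_quot teq_equiv}) s.
Definition tens_repr (x : tensor) : seq (U * V) :=
  repr (x : {eq_quot teq_equiv}).

Lemma tens_ofK x : tens_of (tens_repr x) = x.
Proof. exact: reprK. Qed.

Lemma tens_ofP s t : tens_of s = tens_of t <-> teq s t.
Proof.
split => [|st]; first by move/eqmodP/asboolP.
by apply/eqmodP/asboolP.
Qed.

Lemma tens_of_repr s : teq (tens_repr (tens_of s)) s.
Proof. by apply/tens_ofP; rewrite tens_ofK. Qed.

Definition pure (u : U) (v : V) : tensor := tens_of [:: (u, v)].

Definition tadd (x y : tensor) := tens_of (tens_repr x ++ tens_repr y).

Lemma taddE s t : tadd (tens_of s) (tens_of t) = tens_of (s ++ t).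
Proof. by apply/tens_ofP; apply: teq_cat; exact: tens_of_repr. Qed.

Lemma taddA : associative tadd.
Proof.
move=> x y z; rewrite -(tens_ofK x) -(tens_ofK y) -(tens_ofK z).
by rewrite !taddE catA.
Qed.
Lemma taddC : commutative tadd.
Proof. by move=> x y; apply/tens_ofP; exact: teq_catC. Qed.
Lemma tadd0 : left_id (tens_of [::]) tadd.
Proof. by move=> x; rewrite -(tens_ofK x) taddE. Qed.

HB.instance Definition _ := GRing.isNmodule.Build tensor taddA taddC tadd0.

Lemma tens_of_cat s t : tens_of (s ++ t) = tens_of s + tens_of t.
Proof. by rewrite -taddE. Qed.

Lemma tens_of_sum s : tens_of s = \sum_(p <- s) pure p.1 p.2.
Proof.
elim: s => [|[u v] s IHs]; first by rewrite big_nil.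
by rewrite big_cons -IHs -tens_of_cat.
Qed.

Lemma tensor_ind (P : tensor -> Prop) :
  P 0 -> (forall x y, P x -> P y -> P (x + y)) ->
  (forall u v, P (pure u v)) -> forall x, P x.
Proof.
move=> P0 PD Pp x; rewrite -(tens_ofK x) tens_of_sum.
by elim/big_ind: _ => // p _; apply: Pp.
Qed.

Definition tact (g : U -> U) (x : tensor) : tensor :=
  tens_of [seq (g p.1, p.2) | p <- tens_repr x].

Section Tact.
Variable g : U -> U.
Hypothesis gL : linear g.

Lemma teq_act (s t : seq (U * V)) : teq s t ->
  teq [seq (g p.1, p.2) | p <- s] [seq (g p.1, p.2) | p <- t].
Proof.
have g0 : g 0 = 0 by have := gL (-1) 0 0; rewrite scaler0 addr0 scaleN1r addNr.
have gD u v : g (u + v) = g u + g v by have := gL 1 u v; rewrite !scale1r.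
have gZ c u : g (c *: u) = c *: g u by have := gL c u 0; rewrite g0 !addr0.
elim=> /= {s t} [*|*|s t r _ + _|s s' t t' _ + _|*|*|*|*|*].
- exact: teq_refl.
- exact: teq_sym.
- exact: teq_trans.
- by rewrite !map_cat; exact: teq_cat.
- by rewrite !map_cat; exact: teq_catC.
- by rewrite gD; exact: teq_addl.
- exact: teq_addr.
- by rewrite gZ; exact: teq_scale.
- by rewrite g0; exact: teq_zero.
Qed.

Lemma tactE (s : seq (U * V)) : tact g (tens_of s) = tens_of [seq (g p.1, p.2) | p <- s].
Proof. by apply/tens_ofP; apply: teq_act; exact: tens_of_repr. Qed.

Lemma tact0 : tact g 0 = 0.
Proof. exact: (tactE [::]). Qed.
Lemma tact_pure u v : tact g (pure u v) = pure (g u) v.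
Proof. exact: tactE. Qed.
Lemma tactD x y : tact g (x + y) = tact g x + tact g y.
Proof.
rewrite -(tens_ofK x) -(tens_ofK y) -tens_of_cat !tactE map_cat.
exact: tens_of_cat.
Qed.
End Tact.

Lemma pureDl u u' v : pure (u + u') v = pure u v + pure u' v.
Proof. by rewrite -tens_of_cat; apply/tens_ofP; exact: teq_addl. Qed.
Lemma pureDr u v v' : pure u (v + v') = pure u v + pure u v'.
Proof. by rewrite -tens_of_cat; apply/tens_ofP; exact: teq_addr. Qed.
Lemma pure0l v : pure 0 v = 0.
Proof. by apply/tens_ofP; exact: teq_zero. Qed.
Lemma pureZlr c u v : pure (c *: u) v = pure u (c *: v).
Proof. by apply/tens_ofP; exact: teq_scale. Qed.

Lemma scale_linear (c : k) : linear ( *:%R c : U -> U).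
Proof. by move=> a u v; rewrite scalerDr !scalerA mulrC. Qed.
Lemma opp_linear : linear (-%R : U -> U).
Proof. by move=> a u v; rewrite opprD scalerN. Qed.

Lemma tensNr : left_inverse 0 (tact -%R) +%R.
Proof.
elim/tensor_ind => [|x y Hx Hy|u v]; first by rewrite (tact0 opp_linear) addr0.
  by rewrite (tactD opp_linear) addrACA Hx Hy addr0.
by rewrite (tact_pure opp_linear) -pureDl addNr pure0l.
Qed.

HB.instance Definition _ := GRing.Nmodule_isZmodule.Build tensor tensNr.

Definition tscale (c : k) : tensor -> tensor := tact ( *:%R c).

Lemma tscale_pure c u v : tscale c (pure u v) = pure (c *: u) v.
Proof. exact: tact_pure (scale_linear c) u v. Qed.
Lemma tscale0 c : tscale c 0 = 0. Proof. exact: tact0 (scale_linear c). Qed.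
Lemma tscaleA a b x : tscale a (tscale b x) = tscale (a * b) x.
Proof.
elim/tensor_ind: x => [|x y Hx Hy|u v]; first by rewrite !tscale0.
  by rewrite /tscale !(tactD (scale_linear _)) -!/(tscale _ _) Hx Hy.
by rewrite !tscale_pure scalerA.
Qed.
Lemma tscale1 : left_id 1 tscale.
Proof.
elim/tensor_ind => [|x y Hx Hy|u v]; first by rewrite tscale0.
  by rewrite /tscale !(tactD (scale_linear _)) -!/(tscale _ _) Hx Hy.
by rewrite tscale_pure scale1r.
Qed.
Lemma tscaleDr : right_distributive tscale +%R.
Proof. by move=> c x y; exact: tactD (scale_linear c) x y. Qed.
Lemma tscaleDl x : {morph tscale^~ x : a b / a + b}.
Proof.
move=> a b; elim/tensor_ind: x => [|x y Hx Hy|u v].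
- by rewrite !tscale0 addr0.
- by rewrite /= !tscaleDr Hx Hy addrACA.
- by rewrite /= !tscale_pure scalerDl pureDl.
Qed.

HB.instance Definition _ :=
  GRing.Zmodule_isLmodule.Build k tensor tscaleA tscale1 tscaleDr tscaleDl.

Lemma pureZl c u v : pure (c *: u) v = c *: pure u v.
Proof. by rewrite -tscale_pure. Qed.
Lemma pureZr c u v : pure u (c *: v) = c *: pure u v.
Proof. by rewrite -pureZlr pureZl. Qed.

Definition bilin (W : lmodType k) (f : U -> V -> W) :=
  (forall v, linear (f^~ v)) /\ (forall u, linear (f u)).

Lemma pure_bilin : bilin pure.
Proof. by split=> [v|u] a x y /=; rewrite ?pureDl ?pureDr ?pureZl ?pureZr. Qed.

(* The linear map induced by the bilinear map f; when f is not bilinear the    *)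
(* value depends on the chosen representative.                                 *)
Definition tlift (W : lmodType k) (f : U -> V -> W) (x : tensor) : W :=
  \sum_(p <- tens_repr x) f p.1 p.2.

Section Lift.
Variables (W : lmodType k) (f : U -> V -> W).
Hypothesis fL : bilin f.

Lemma tlift_teq (s t : seq (U * V)) : teq s t ->
  \sum_(p <- s) f p.1 p.2 = \sum_(p <- t) f p.1 p.2.
Proof.
have [fl fr] := fL.
have f0 v : f 0 v = 0.
  by have := fl v (-1) 0 0; rewrite scaler0 addr0 scaleN1r addNr.
have f0r u : f u 0 = 0.
  by have := fr u (-1) 0 0; rewrite scaler0 addr0 scaleN1r addNr.
elim=> {s t} [*|*|s t r _ + _|s s' t t' _ + _|*|u u' v|u v v'|c u v|v] //=.
- by move=> -> ->.
- by rewrite !big_cat /= => -> ->.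
- by rewrite !big_cat /= addrC.
- by rewrite !big_cons !big_nil /= !addr0; have := fl v 1 u u'; rewrite !scale1r.
- by rewrite !big_cons !big_nil /= !addr0; have := fr u 1 v v'; rewrite !scale1r.
- rewrite !big_cons !big_nil /= !addr0.
  have := fl v c u 0; rewrite f0 !addr0 => ->.
  by have := fr u c v 0; rewrite f0r !addr0 => ->.
- by rewrite !big_cons !big_nil /= f0 addr0.
Qed.

Lemma tlift_of s : tlift f (tens_of s) = \sum_(p <- s) f p.1 p.2.
Proof. exact: tlift_teq (tens_of_repr s). Qed.

Lemma tlift_pure u v : tlift f (pure u v) = f u v.
Proof. by rewrite tlift_of big_seq1. Qed.

Lemma tlift0 : tlift f 0 = 0.
Proof. by rewrite (tlift_of [::]) big_nil. Qed.

Lemma tliftD x y : tlift f (x + y) = tlift f x + tlift f y.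
Proof.
by rewrite -(tens_ofK x) -(tens_ofK y) -tens_of_cat !tlift_of big_cat.
Qed.

Lemma tliftZ c x : tlift f (c *: x) = c *: tlift f x.
Proof.
elim/tensor_ind: x => [|x y Hx Hy|u v].
- by rewrite scaler0 tlift0 scaler0.
- by rewrite scalerDr !tliftD Hx Hy scalerDr.
have [fl _] := fL; have := fl v c u 0.
have -> : f 0 v = 0.
  by have := fl v (-1) 0 0; rewrite scaler0 addr0 scaleN1r addNr.
by rewrite -pureZl !tlift_pure !addr0.
Qed.

Lemma tlift_linear : linear (tlift f).
Proof. by move=> a x y; rewrite tliftD tliftZ. Qed.
End Lift.

End TensorType.

Arguments tlift {k U V W} f x.

Notation "U ⊗ V" := (tensor U%type V%type) : type_scope.
Notation "u ⊗ v" := (pure u v) : ring_scope.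

(* A subspace maximal among those avoiding w is the kernel of a functional phi *)
(* with phi w = 1; this gives 1 ⊗ 1 != 0 below.                                *)
Lemma exists_functional (k : fieldType) (V : lmodType k) (w : V) : w != 0 ->
  exists phi : V -> k^o, linear phi /\ phi w = 1.
Proof.
move=> w0.
pose P := [set W : set V | [/\ forall a x y, W x -> W y -> W (a *: x + y)
                            & ~ W w]]%classic.
have [F FP Fch|M [[Mlin Mw] Mmax]] := Zorn_bigcup (P := P).
  split=> [a x y [X FX Xx] [Y FY Yy]|[X FX Xw]]; last by have [] := FP _ FX.
  have [XY|YX] := Fch _ _ FX FY.
    by exists Y => //; have [YL _] := FP _ FY; apply: YL => //; exact: XY.
  by exists X => //; have [XL _] := FP _ FX; apply: XL => //; exact: YX.
have M0 : M 0.
  apply: contrapT => nM0.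
  have ME x : ~ M x.
    by move=> Mx; apply: nM0; have := Mlin (-1) x x Mx Mx; rewrite scaleN1r addNr.
  apply: (Mmax [set 0]%classic).
    by split=> [x /ME //|/(_ 0 erefl)].
  split=> [a x y -> ->|/= /eqP]; first by rewrite /= scaler0 addr0.
  exact/negP.
have ex v : exists c : k, M (v - c *: w).
  have [Mv|Mv] := pselect (M v); first by exists 0; rewrite scale0r subr0.
  pose N := [set x | exists c : k, M (x - c *: v)]%classic.
  have NP : ~ P N.
    apply: Mmax; split=> [x Mx|/(_ v) NM].
      by exists 0; rewrite scale0r subr0.
    by apply: Mv; apply: NM; exists 1; rewrite scale1r subrr.
  have [c Mc] : N w.
    apply: contrapT => Nw; apply: NP; split => // a x y [c Mx] [d My].
    exists (a * c + d); have := Mlin a _ _ Mx My.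
    by rewrite scalerBr scalerA addrACA -opprD -scalerDl.
  have c0 : c != 0.
    by apply/eqP => c0; apply: Mw; move: Mc; rewrite c0 scale0r subr0.
  exists c^-1; have := Mlin (- c^-1) _ _ Mc M0.
  by rewrite addr0 scalerBr scalerA mulNr mulVf // !scaleNr scale1r opprK addrC.
have uniq v c d : M (v - c *: w) -> M (v - d *: w) -> c = d.
  move=> Mc Md; apply/eqP; rewrite -subr_eq0; apply: contrapT => /negP cd.
  apply: Mw; have := Mlin (-1) _ _ Mc Md.
  rewrite scaleN1r opprB addrA addrNK -scalerBl => Mcd.
  by have := Mlin (c - d)^-1 _ _ Mcd M0; rewrite addr0 scalerA mulVf // scale1r.
pose phi v : k^o := sval (cid (ex v)).
have phiP v : M (v - phi v *: w) by rewrite /phi; case: cid.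
exists phi; split.
  move=> a x y; apply: (uniq (a *: x + y)) => //.
  have := Mlin a _ _ (phiP x) (phiP y).
  by rewrite scalerBr scalerA addrACA -opprD -scalerDl.
by apply: (uniq w) => //; rewrite scale1r subrr.
Qed.

Section TensorAlgebra.
Context {k : fieldType}.
Variables A B : algType k.

Definition tmul (x y : A ⊗ B) : A ⊗ B :=
  tlift (fun a b => tlift (fun c d => (a * c) ⊗ (b * d)) y) x.

Lemma tmul_bilin1 (a : A) (b : B) :
  bilin (fun (c : A) (d : B) => (a * c) ⊗ (b * d)).
Proof.
by split=> [d|c] z x y /=; rewrite mulrDr -scalerAr
  ?pureDl ?pureDr ?pureZl ?pureZr.
Qed.

Lemma tmul_bilin2 (y : A ⊗ B) :
  bilin (fun (a : A) (b : B) => tlift (fun c d => (a * c) ⊗ (b * d)) y).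
Proof.
split=> [b|a] z u v /=; rewrite /tlift scaler_sumr -big_split /=;
  apply: eq_bigr => p _; rewrite mulrDl -scalerAl.
  by rewrite pureDl pureZl.
by rewrite pureDr pureZr.
Qed.

Lemma tmul_pure a b c d : tmul (a ⊗ b) (c ⊗ d) = (a * c) ⊗ (b * d).
Proof.
by rewrite /tmul (tlift_pure (tmul_bilin2 _)) (tlift_pure (tmul_bilin1 _ _)).
Qed.

Lemma tmulDl : left_distributive tmul +%R.
Proof. by move=> x y z; exact: tliftD (tmul_bilin2 z) x y. Qed.
Lemma tmulZl c x y : tmul (c *: x) y = c *: tmul x y.
Proof. exact: tliftZ (tmul_bilin2 y) c x. Qed.
Lemma tmul0l x : tmul 0 x = 0.
Proof. exact: tlift0 (tmul_bilin2 x). Qed.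
Lemma tmulDr : right_distributive tmul +%R.
Proof.
move=> x y z; rewrite /tmul -big_split /=; apply: eq_bigr => p _.
exact: tliftD (tmul_bilin1 _ _) y z.
Qed.
Lemma tmulZr c x y : tmul x (c *: y) = c *: tmul x y.
Proof.
rewrite /tmul /tlift scaler_sumr; apply: eq_bigr => p _.
exact: tliftZ (tmul_bilin1 _ _) c y.
Qed.
Lemma tmul0r x : tmul x 0 = 0.
Proof. by have := tmulZr 0 x 0; rewrite !scale0r. Qed.

Lemma tmulA : associative tmul.
Proof.
move=> x y z; elim/(@tensor_ind k A B): x => [|x x' Hx Hx'|a b].
- by rewrite !tmul0l.
- by rewrite !tmulDl Hx Hx'.
elim/(@tensor_ind k A B): y => [|y y' Hy Hy'|c d].
- by rewrite !(tmul0l, tmul0r).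
- by rewrite !(tmulDl, tmulDr) Hy Hy'.
elim/(@tensor_ind k A B): z => [|z z' Hz Hz'|e f].
- by rewrite !tmul0r.
- by rewrite !tmulDr Hz Hz'.
by rewrite !tmul_pure !mulrA.
Qed.

Lemma tmul1l : left_id (1 ⊗ 1) tmul.
Proof.
elim/(@tensor_ind k A B) => [|x y Hx Hy|a b]; first exact: tmul0r.
  by rewrite tmulDr Hx Hy.
by rewrite tmul_pure !mul1r.
Qed.
Lemma tmul1r : right_id (1 ⊗ 1) tmul.
Proof.
elim/(@tensor_ind k A B) => [|x y Hx Hy|a b]; first exact: tmul0l.
  by rewrite tmulDl Hx Hy.
by rewrite tmul_pure !mulr1.
Qed.

Lemma tone_neq0 : (1 : A) ⊗ (1 : B) != 0.
Proof.
have [f [fl f1]] := exists_functional (oner_neq0 A).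
have [g [gl g1]] := exists_functional (oner_neq0 B).
have fgL : bilin (fun a b => f a * g b : k^o).
  split=> [b|a] c x y /=.
    by rewrite fl mulrDl; congr (_ + _); rewrite /GRing.scale /= mulrA.
  by rewrite gl mulrDr; congr (_ + _); rewrite /GRing.scale /= mulrCA.
apply/eqP => /(congr1 (tlift (fun a b => f a * g b : k^o))).
rewrite (tlift_pure fgL) (tlift0 fgL) f1 g1 mulr1 => /eqP.
by rewrite oner_eq0.
Qed.

HB.instance Definition _ := GRing.Zmodule_isNzRing.Build (tensor A B)
  tmulA tmul1l tmul1r tmulDl tmulDr tone_neq0.

Lemma tens_scaleAl (c : k) (x y : A ⊗ B) : c *: (x * y) = (c *: x) * y.
Proof. by rewrite [RHS]tmulZl. Qed.
Lemma tens_scaleAr (c : k) (x y : A ⊗ B) : c *: (x * y) = x * (c *: y).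
Proof. by rewrite [RHS]tmulZr. Qed.

HB.instance Definition _ :=
  GRing.Lmodule_isLalgebra.Build k (tensor A B) tens_scaleAl.
HB.instance Definition _ :=
  GRing.Lalgebra_isAlgebra.Build k (tensor A B) tens_scaleAr.

Lemma pureM (a c : A) (b d : B) : (a ⊗ b) * (c ⊗ d) = (a * c) ⊗ (b * d).
Proof. exact: tmul_pure. Qed.

Lemma pure11 : (1 : A) ⊗ (1 : B) = 1.
Proof. by []. Qed.

End TensorAlgebra.

(* Every nonzero ring has a classical unitRingType structure, so asking for a  *)
(* unitAlgType instead of an algType is no restriction.                        *)
Section ClassicalInverse.
Variable R : nzRingType.

Definition cunit : {pred R} :=
  fun x => `[< exists y, y * x = 1 /\ x * y = 1 >].
Definition cinv (x : R) : R :=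
  if pselect (exists y, y * x = 1 /\ x * y = 1) is left e then sval (cid e)
  else x.

Lemma cmulV : {in cunit, left_inverse 1 cinv *%R}.
Proof.
by move=> x /asboolP ex; rewrite /cinv; case: pselect => // e; case: cid => y [].
Qed.
Lemma cmulrV : {in cunit, right_inverse 1 cinv *%R}.
Proof.
by move=> x /asboolP ex; rewrite /cinv; case: pselect => // e; case: cid => y [].
Qed.
Lemma cunitP x y : y * x = 1 /\ x * y = 1 -> x \in cunit.
Proof. by move=> xy; apply/asboolP; exists y. Qed.
Lemma cinv_out : {in [predC cunit], cinv =1 id}.
Proof.
by move=> x /negP nx; rewrite /cinv; case: pselect => // e; case: nx; apply/asboolP.
Qed.
End ClassicalInverse.

HB.instance Definition _ (k : fieldType) (A B : algType k) :=
  GRing.NzRing_hasMulInverse.Build (tensor A B)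
    (@cmulV (tensor A B)) (@cmulrV (tensor A B)) (@cunitP (tensor A B)) (@cinv_out (tensor A B)).

(* Iterated tensor products associate to the right: A ⊗ A ⊗ A is A ⊗ (A ⊗ A).  *)
Section TensorMaps.
Context {k : fieldType}.

Definition tmap (U U' V V' : lmodType k) (f : U -> U') (g : V -> V') :
    U ⊗ V -> U' ⊗ V' :=
  tlift (fun u v => f u ⊗ g v).

Definition tassoc (U V W : lmodType k) : (U ⊗ V) ⊗ W -> U ⊗ V ⊗ W :=
  tlift (fun uv w => tlift (fun u v => u ⊗ v ⊗ w) uv).

Definition tlift3 (U V W X : lmodType k) (f : U -> V -> W -> X) :
    U ⊗ V ⊗ W -> X :=
  tlift (fun u vw => tlift (fun v w => f u v w) vw).

Variable A : algType k.

Definition leg12 : A ⊗ A -> A ⊗ A ⊗ A := tlift (fun a b => a ⊗ b ⊗ 1).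
Definition leg13 : A ⊗ A -> A ⊗ A ⊗ A := tlift (fun a b => a ⊗ 1 ⊗ b).
Definition leg23 : A ⊗ A -> A ⊗ A ⊗ A := tlift (fun a b => 1 ⊗ a ⊗ b).

(* legijl puts the first leg x in slot i, the second leg y in slot j and the   *)
(* third leg z in slot l.                                                      *)
Definition leg123 : A ⊗ A ⊗ A -> A ⊗ A ⊗ A := id.
Definition leg132 : A ⊗ A ⊗ A -> A ⊗ A ⊗ A := tlift3 (fun x y z => x ⊗ z ⊗ y).
Definition leg213 : A ⊗ A ⊗ A -> A ⊗ A ⊗ A := tlift3 (fun x y z => y ⊗ x ⊗ z).
Definition leg231 : A ⊗ A ⊗ A -> A ⊗ A ⊗ A := tlift3 (fun x y z => z ⊗ x ⊗ y).
Definition leg312 : A ⊗ A ⊗ A -> A ⊗ A ⊗ A := tlift3 (fun x y z => y ⊗ z ⊗ x).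

Definition flip : A ⊗ A -> A ⊗ A := tlift (fun a b => b ⊗ a).

Variables (Delta : A -> A ⊗ A) (eps : A -> k).

(* f_id is f ⊗ id and id_f is id ⊗ f, up to the identifications                *)
(* (A ⊗ A) ⊗ V = A ⊗ (A ⊗ V), k ⊗ V = V and A ⊗ k = A.                         *)
Definition Delta_id (V : lmodType k) : A ⊗ V -> A ⊗ A ⊗ V :=
  fun x => tassoc (tmap Delta id x).
Definition id_Delta : A ⊗ A -> A ⊗ A ⊗ A := tmap id Delta.
Definition eps_id (V : lmodType k) : A ⊗ V -> V := tlift (fun a v => eps a *: v).
Definition id_eps : A ⊗ A -> A := tlift (fun a b => eps b *: a).

Definition Delta_id_id : A ⊗ A ⊗ A -> A ⊗ A ⊗ A ⊗ A := @Delta_id (A ⊗ A)%type.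
Definition id_Delta_id : A ⊗ A ⊗ A -> A ⊗ A ⊗ A ⊗ A := tmap id (@Delta_id A).
Definition id_id_Delta : A ⊗ A ⊗ A -> A ⊗ A ⊗ A ⊗ A := tmap id id_Delta.
Definition id_eps_id : A ⊗ A ⊗ A -> A ⊗ A := tmap id (@eps_id A).

Definition tensor_one (x : A ⊗ A ⊗ A) : A ⊗ A ⊗ A ⊗ A :=
  tlift3 (fun a b c => a ⊗ b ⊗ c ⊗ 1) x.

End TensorMaps.

Arguments Delta_id {k A} Delta {V} x.
Arguments eps_id {k A} eps {V} x.

Record quasi_bialgebra (k : fieldType) (A : unitAlgType k)
    (Delta : {lrmorphism A -> A ⊗ A}) (eps : {lrmorphism A -> k^o})
    (Phi : A ⊗ A ⊗ A) (cr cl : A) : Prop := QuasiBialgebra {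
  qb_Phi_unit : Phi \is a GRing.unit;
  qb_cr_unit : cr \is a GRing.unit;
  qb_cl_unit : cl \is a GRing.unit;
  qb_coassoc : forall a : A,
    id_Delta Delta (Delta a) = Phi * Delta_id Delta (Delta a) * Phi^-1;
  qb_pentagon :
    id_id_Delta Delta Phi * Delta_id_id Delta Phi
      = (1 ⊗ Phi) * id_Delta_id Delta Phi * tensor_one Phi;
  qb_counitl : forall a : A, eps_id eps (Delta a) = cl^-1 * a * cl;
  qb_counitr : forall a : A, id_eps eps (Delta a) = cr^-1 * a * cr;
  qb_triangle : id_eps_id eps Phi = cr ⊗ cl^-1
}.

Record quasi_triangular (k : fieldType) (A : unitAlgType k)
    (Delta : {lrmorphism A -> A ⊗ A}) (eps : {lrmorphism A -> k^o})
    (Phi : A ⊗ A ⊗ A) (cr cl : A) (R : A ⊗ A) : Prop := QuasiTriangular {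
  qt_quasi_bialgebra : quasi_bialgebra Delta eps Phi cr cl;
  qt_R_unit : R \is a GRing.unit;
  qt_cocomm : forall a : A, flip (Delta a) * R = R * Delta a;
  qt_id_Delta :
    id_Delta Delta R
      = (leg231 Phi)^-1 * leg13 R * leg213 Phi * leg12 R * (leg123 Phi)^-1;
  qt_Delta_id :
    Delta_id Delta R
      = leg312 Phi * leg13 R * (leg132 Phi)^-1 * leg23 R * leg123 Phi
}.

(* Main.v *)
(** The hypothesis of (1) says that R_12 intertwines Phi_123 and Phi_213; moving
    it to the slots 1, 3 it gives Phi_312 R_13 = R_13 Phi_132, and the hexagons
    lose all but one associator.  Comparing the second hexagon with its flip via
    Delta^op R = R Delta then gives the Yang-Baxter equation up to a factor Phi,
    which cancels.  The pentagon with the counit applied in two adjacent outer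
    slots computes (eps ⊗ id ⊗ id) Phi = Delta(cl^-1) (cl ⊗ 1) and
    (id ⊗ id ⊗ eps) Phi = (1 ⊗ cr^-1) Delta(cr).  With the counit in the third
    slot, the hypothesis becomes (cr^-1 ⊗ 1) R = R (1 ⊗ cr^-1), and a second
    counit forces cr = 1; the counits of R are then read off the hexagons.
    Part (2) is the mirror image. *)
Require Import Defs.
From HB Require Import structures.
From mathcomp Require Import all_boot all_algebra.

Import GRing.Theory.
Local Open Scope ring_scope.

Set Implicit Arguments.
Unset Strict Implicit.
Unset Printing Implicit Defensive.

(** * Linear maps out of tensor products and their values on pure tensors *)

Lemma pure0r (k : fieldType) (U V : lmodType k) (u : U) : u ⊗ (0 : V) = 0.
Proof. by rewrite -(scale0r (0 : V)) pureZr scale0r. Qed.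

(* Reduces a goal that is linear in [x] to pure tensors. *)
Ltac tensor_elim x :=
  move: x; refine (tensor_ind _ _ _);
  [ rewrite ?(pure0l, pure0r, raddf0, mul0r, mulr0, scale0r) //
  | let Hx := fresh in let Hy := fresh in
    move=> ? ? Hx Hy;
    by rewrite ?(pureDl, pureDr, raddfD, mulrDl, mulrDr, scalerDl) /= Hx Hy
  | ].

Section LinearMaps.
Context {k : fieldType}.
Variables U U' V V' W : lmodType k.

Lemma tmap_bilin (f : {linear U -> U'}) (g : {linear V -> V'}) :
  bilin (fun u v => f u ⊗ g v).
Proof.
by split=> [v|u] c x y /=; rewrite linearP ?pureDl ?pureDr ?pureZl ?pureZr.
Qed.

Lemma tmap_pure (f : {linear U -> U'}) (g : {linear V -> V'}) u v :
  tmap f g (u ⊗ v) = f u ⊗ g v.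
Proof. exact: tlift_pure (tmap_bilin f g) u v. Qed.

HB.instance Definition _ (f : {linear U -> U'}) (g : {linear V -> V'}) :=
  GRing.isLinear.Build k (U ⊗ V)%type (U' ⊗ V')%type *:%R (tmap f g)
    (tlift_linear (tmap_bilin f g)).

Lemma pure_pure_bilin (w : W) : bilin (fun (u : U) (v : V) => u ⊗ v ⊗ w).
Proof.
by split=> [v|u] c x y /=; rewrite ?pureDl ?pureDr ?pureZl ?pureZr.
Qed.

Lemma tassoc_bilin :
  bilin (fun (x : U ⊗ V) (w : W) => tlift (fun u v => u ⊗ v ⊗ w) x).
Proof.
split=> [w|x]; first exact: tlift_linear (pure_pure_bilin w).
(* For fixed [x], [tlift] is a sum over one chosen representative of [x], so linearity in [w] holds
   term by term. *)
move=> c w w'; rewrite /tlift scaler_sumr -big_split /=.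
by apply: eq_bigr => p _; rewrite !pureDr !pureZr.
Qed.

Lemma tassoc_pure (u : U) (v : V) (w : W) :
  tassoc ((u ⊗ v) ⊗ w) = u ⊗ v ⊗ w.
Proof.
by rewrite /tassoc (tlift_pure tassoc_bilin) (tlift_pure (pure_pure_bilin w)).
Qed.

HB.instance Definition _ :=
  GRing.isLinear.Build k ((U ⊗ V) ⊗ W)%type (U ⊗ V ⊗ W)%type *:%R
    (@tassoc k U V W)
    (tlift_linear tassoc_bilin).

Section Lift3.
Variable f : U -> V -> W -> U'.
Hypotheses (f1 : forall v w, linear (fun u => f u v w))
  (f2 : forall u w, linear (fun v => f u v w))
  (f3 : forall u v, linear (f u v)).

Lemma tlift3_bilin1 u : bilin (f u).
Proof. by split=> [w|v]; [exact: f2|exact: f3]. Qed.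

Lemma tlift3_bilin2 :
  bilin (fun u (x : V ⊗ W) => tlift (fun v w => f u v w) x).
Proof.
split=> [x|u]; last exact: tlift_linear (tlift3_bilin1 u).
move=> c u u'; rewrite /tlift scaler_sumr -big_split /=.
by apply: eq_bigr => p _; exact: f1.
Qed.

Lemma tlift3_linear : linear (tlift3 f).
Proof. exact: tlift_linear tlift3_bilin2. Qed.

Lemma tlift3_pure u v w : tlift3 f (u ⊗ v ⊗ w) = f u v w.
Proof.
by rewrite /tlift3 (tlift_pure tlift3_bilin2) (tlift_pure (tlift3_bilin1 u)).
Qed.
End Lift3.

End LinearMaps.

Ltac trilinear :=
  by move=> > /=; rewrite ?(pureDl, pureDr, pureZl, pureZr).

Ltac bilinear :=
  split=> > /=; by rewrite ?(pureDl, pureDr, pureZl, pureZr).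

(** * Placing tensor legs in prescribed slots *)

Section Legs.
Context {k : fieldType}.
Variable A : algType k.

Lemma leg12_bilin : bilin (fun a b : A => a ⊗ b ⊗ (1 : A)).
Proof. bilinear. Qed.
Lemma leg13_bilin : bilin (fun a b : A => a ⊗ (1 : A) ⊗ b).
Proof. bilinear. Qed.
Lemma leg23_bilin : bilin (fun a b : A => (1 : A) ⊗ a ⊗ b).
Proof. bilinear. Qed.
Lemma flip_bilin : bilin (fun a b : A => b ⊗ a).
Proof. bilinear. Qed.

Lemma leg12_pure (a b : A) : leg12 (a ⊗ b) = a ⊗ b ⊗ 1.
Proof. exact: tlift_pure leg12_bilin a b. Qed.
Lemma leg13_pure (a b : A) : leg13 (a ⊗ b) = a ⊗ 1 ⊗ b.
Proof. exact: tlift_pure leg13_bilin a b. Qed.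
Lemma leg23_pure (a b : A) : leg23 (a ⊗ b) = 1 ⊗ a ⊗ b.
Proof. exact: tlift_pure leg23_bilin a b. Qed.
Lemma flip_pure (a b : A) : flip (a ⊗ b) = b ⊗ a.
Proof. exact: tlift_pure flip_bilin a b. Qed.
Lemma leg132_pure (a b c : A) : leg132 (a ⊗ b ⊗ c) = a ⊗ c ⊗ b.
Proof. by apply: tlift3_pure; trilinear. Qed.
Lemma leg213_pure (a b c : A) : leg213 (a ⊗ b ⊗ c) = b ⊗ a ⊗ c.
Proof. by apply: tlift3_pure; trilinear. Qed.
Lemma leg231_pure (a b c : A) : leg231 (a ⊗ b ⊗ c) = c ⊗ a ⊗ b.
Proof. by apply: tlift3_pure; trilinear. Qed.
Lemma leg312_pure (a b c : A) : leg312 (a ⊗ b ⊗ c) = b ⊗ c ⊗ a.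
Proof. by apply: tlift3_pure; trilinear. Qed.
Lemma tensor_one_pure (a b c : A) : tensor_one (a ⊗ b ⊗ c) = a ⊗ b ⊗ c ⊗ 1.
Proof. by apply: tlift3_pure; trilinear. Qed.

Lemma leg132_linear : linear (@leg132 k A).
Proof. by apply: tlift3_linear; trilinear. Qed.
Lemma leg213_linear : linear (@leg213 k A).
Proof. by apply: tlift3_linear; trilinear. Qed.
Lemma leg231_linear : linear (@leg231 k A).
Proof. by apply: tlift3_linear; trilinear. Qed.
Lemma leg312_linear : linear (@leg312 k A).
Proof. by apply: tlift3_linear; trilinear. Qed.
Lemma tensor_one_linear : linear (@tensor_one k A).
Proof. by apply: tlift3_linear; trilinear. Qed.

HB.instance Definition _ := GRing.isLinear.Build k
  (A ⊗ A)%type (A ⊗ A ⊗ A)%type *:%R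
  (@leg12 k A) (tlift_linear leg12_bilin).
HB.instance Definition _ := GRing.isLinear.Build k
  (A ⊗ A)%type (A ⊗ A ⊗ A)%type *:%R
  (@leg13 k A) (tlift_linear leg13_bilin).
HB.instance Definition _ := GRing.isLinear.Build k
  (A ⊗ A)%type (A ⊗ A ⊗ A)%type *:%R
  (@leg23 k A) (tlift_linear leg23_bilin).
HB.instance Definition _ := GRing.isLinear.Build k
  (A ⊗ A)%type (A ⊗ A)%type *:%R
  (@flip k A) (tlift_linear flip_bilin).
HB.instance Definition _ := GRing.isLinear.Build k
  (A ⊗ A ⊗ A)%type (A ⊗ A ⊗ A)%type *:%R
  (@leg132 k A) leg132_linear.
HB.instance Definition _ := GRing.isLinear.Build k
  (A ⊗ A ⊗ A)%type (A ⊗ A ⊗ A)%type *:%R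
  (@leg213 k A) leg213_linear.
HB.instance Definition _ := GRing.isLinear.Build k
  (A ⊗ A ⊗ A)%type (A ⊗ A ⊗ A)%type *:%R
  (@leg231 k A) leg231_linear.
HB.instance Definition _ := GRing.isLinear.Build k
  (A ⊗ A ⊗ A)%type (A ⊗ A ⊗ A)%type *:%R
  (@leg312 k A) leg312_linear.
HB.instance Definition _ := GRing.isLinear.Build k
  (A ⊗ A ⊗ A)%type (A ⊗ A ⊗ A ⊗ A)%type
  *:%R (@tensor_one k A) tensor_one_linear.

(** Both sides of [f (x * y) = f x * f y] are bilinear in [x] and [y], and pure tensors span. *)
Lemma tensor_monoid_morphism (B C : algType k)
    (f : {linear (A ⊗ B)%type -> C}) :
  f 1 = 1 ->
  (forall a b c d, f ((a ⊗ b) * (c ⊗ d)) = f (a ⊗ b) * f (c ⊗ d)) ->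
  monoid_morphism f.
Proof.
move=> f1 fM; split=> // x y.
by tensor_elim x => ? ?; tensor_elim y.
Qed.

Lemma tensor3_monoid_morphism (B C D : algType k)
    (f : {linear (A ⊗ B ⊗ C)%type -> D}) :
  f 1 = 1 ->
  (forall a b c a' b' c', f ((a ⊗ b ⊗ c) * (a' ⊗ b' ⊗ c'))
     = f (a ⊗ b ⊗ c) * f (a' ⊗ b' ⊗ c')) ->
  monoid_morphism f.
Proof.
move=> f1 fM; apply: tensor_monoid_morphism => // a x b y.
by tensor_elim x => ? ?; tensor_elim y.
Qed.

End Legs.

(** * Slot placements as algebra morphisms, and their composites *)

Section MultiplicativeLegs.
Context {k : fieldType}.
Variable A : algType k.

Lemma leg12_monoid_morphism : monoid_morphism (@leg12 k A).
Proof.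
apply: tensor_monoid_morphism => [|a b c d]; first exact: leg12_pure.
by rewrite /= pureM !leg12_pure !pureM mulr1.
Qed.
Lemma leg13_monoid_morphism : monoid_morphism (@leg13 k A).
Proof.
apply: tensor_monoid_morphism => [|a b c d]; first exact: leg13_pure.
by rewrite /= pureM !leg13_pure !pureM mulr1.
Qed.
Lemma leg23_monoid_morphism : monoid_morphism (@leg23 k A).
Proof.
apply: tensor_monoid_morphism => [|a b c d]; first exact: leg23_pure.
by rewrite /= pureM !leg23_pure !pureM mulr1.
Qed.
Lemma flip_monoid_morphism : monoid_morphism (@flip k A).
Proof.
apply: tensor_monoid_morphism => [|a b c d]; first exact: flip_pure.
by rewrite /= pureM !flip_pure !pureM.
Qed.
Lemma leg132_monoid_morphism : monoid_morphism (@leg132 k A).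
Proof.
apply: tensor3_monoid_morphism => [|a b c a' b' c']; first exact: leg132_pure.
by rewrite /= !pureM !leg132_pure !pureM.
Qed.
Lemma leg213_monoid_morphism : monoid_morphism (@leg213 k A).
Proof.
apply: tensor3_monoid_morphism => [|a b c a' b' c']; first exact: leg213_pure.
by rewrite /= !pureM !leg213_pure !pureM.
Qed.
Lemma leg231_monoid_morphism : monoid_morphism (@leg231 k A).
Proof.
apply: tensor3_monoid_morphism => [|a b c a' b' c']; first exact: leg231_pure.
by rewrite /= !pureM !leg231_pure !pureM.
Qed.
Lemma leg312_monoid_morphism : monoid_morphism (@leg312 k A).
Proof.
apply: tensor3_monoid_morphism => [|a b c a' b' c']; first exact: leg312_pure.
by rewrite /= !pureM !leg312_pure !pureM.
Qed.

HB.instance Definition _ := GRing.isMonoidMorphism.Build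
  (A ⊗ A)%type (A ⊗ A ⊗ A)%type (@leg12 k A) leg12_monoid_morphism.
HB.instance Definition _ := GRing.isMonoidMorphism.Build
  (A ⊗ A)%type (A ⊗ A ⊗ A)%type (@leg13 k A) leg13_monoid_morphism.
HB.instance Definition _ := GRing.isMonoidMorphism.Build
  (A ⊗ A)%type (A ⊗ A ⊗ A)%type (@leg23 k A) leg23_monoid_morphism.
HB.instance Definition _ := GRing.isMonoidMorphism.Build
  (A ⊗ A)%type (A ⊗ A)%type (@flip k A) flip_monoid_morphism.
HB.instance Definition _ := GRing.isMonoidMorphism.Build
  (A ⊗ A ⊗ A)%type (A ⊗ A ⊗ A)%type (@leg132 k A) leg132_monoid_morphism.
HB.instance Definition _ := GRing.isMonoidMorphism.Build
  (A ⊗ A ⊗ A)%type (A ⊗ A ⊗ A)%type (@leg213 k A) leg213_monoid_morphism.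
HB.instance Definition _ := GRing.isMonoidMorphism.Build
  (A ⊗ A ⊗ A)%type (A ⊗ A ⊗ A)%type (@leg231 k A) leg231_monoid_morphism.
HB.instance Definition _ := GRing.isMonoidMorphism.Build
  (A ⊗ A ⊗ A)%type (A ⊗ A ⊗ A)%type (@leg312 k A) leg312_monoid_morphism.

Lemma leg23E (x : A ⊗ A) : leg23 x = 1 ⊗ x.
Proof. by tensor_elim x => a b; rewrite leg23_pure. Qed.

(** This and the next identities let a transposition of slots carry the hypothesis of each half of
    the theorem to the slots 1 and 3. *)
Lemma leg132_leg213 (x : A ⊗ A ⊗ A) : leg132 (leg213 x) = leg312 x.
Proof.
tensor_elim x => a x; tensor_elim x => b c.
by rewrite leg213_pure leg132_pure leg312_pure.
Qed.
Lemma leg213_leg132 (x : A ⊗ A ⊗ A) : leg213 (leg132 x) = leg231 x.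
Proof.
tensor_elim x => a x; tensor_elim x => b c.
by rewrite leg132_pure leg213_pure leg231_pure.
Qed.
Lemma leg132_leg12 (x : A ⊗ A) : leg132 (leg12 x) = leg13 x.
Proof. by tensor_elim x => a b; rewrite leg12_pure leg132_pure leg13_pure. Qed.
Lemma leg132_leg13 (x : A ⊗ A) : leg132 (leg13 x) = leg12 x.
Proof. by tensor_elim x => a b; rewrite leg13_pure leg132_pure leg12_pure. Qed.
Lemma leg213_leg13 (x : A ⊗ A) : leg213 (leg13 x) = leg23 x.
Proof. by tensor_elim x => a b; rewrite leg13_pure leg213_pure leg23_pure. Qed.
Lemma leg213_leg23 (x : A ⊗ A) : leg213 (leg23 x) = leg13 x.
Proof. by tensor_elim x => a b; rewrite leg23_pure leg213_pure leg13_pure. Qed.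

End MultiplicativeLegs.

(** * The coproduct applied in one slot *)

Section CoproductMaps.
Context {k : fieldType}.
Variables (A : algType k) (D : {linear A -> (A ⊗ A)%type}).

Lemma Delta_id_pure (V : lmodType k) (a : A) (v : V) :
  Delta_id D (a ⊗ v) = tassoc (D a ⊗ v).
Proof. by rewrite /Delta_id (tmap_pure _ idfun). Qed.

Lemma id_Delta_pure (a b : A) : id_Delta D (a ⊗ b) = a ⊗ D b.
Proof. exact: (tmap_pure idfun). Qed.

Lemma Delta_id_linear (V : lmodType k) : linear (@Delta_id k A D V).
Proof.
move=> c x y; rewrite /Delta_id.
by rewrite (linearP (tmap D (idfun : {linear V -> V}))) linearP.
Qed.

HB.instance Definition _ (V : lmodType k) := GRing.isLinear.Build k
  (A ⊗ V)%type (A ⊗ A ⊗ V)%type *:%R (@Delta_id k A D V) (@Delta_id_linear V).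

HB.instance Definition _ := GRing.isLinear.Build k
  (A ⊗ A)%type (A ⊗ A ⊗ A)%type *:%R (id_Delta D)
  (linearP (tmap (idfun : {linear A -> A}) D)).

Lemma id_Delta_id_pure (a : A) (x : (A ⊗ A)%type) :
  id_Delta_id D (a ⊗ x) = a ⊗ Delta_id D x.
Proof. exact: (tmap_pure idfun (@Delta_id k A D A)). Qed.

Lemma id_id_Delta_pure (a : A) (x : (A ⊗ A)%type) :
  id_id_Delta D (a ⊗ x) = a ⊗ id_Delta D x.
Proof. exact: (tmap_pure idfun (id_Delta D)). Qed.

HB.instance Definition _ := GRing.isLinear.Build k
  (A ⊗ A ⊗ A)%type (A ⊗ A ⊗ A ⊗ A)%type *:%R (id_Delta_id D)
  (linearP (tmap (idfun : {linear A -> A}) (@Delta_id k A D A))).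

HB.instance Definition _ := GRing.isLinear.Build k
  (A ⊗ A ⊗ A)%type (A ⊗ A ⊗ A ⊗ A)%type *:%R (id_id_Delta D)
  (linearP (tmap (idfun : {linear A -> A}) (id_Delta D))).

(** Swapping the first two slots turns [D] into its opposite there, so the assumption on [r] applies
    in these slots, while the third leg commutes with [leg12 r]. With [x] and [r] both equal to the
    R-matrix this is the source of the Yang-Baxter equation in (1). *)
Lemma leg213_Delta_id (x r : A ⊗ A) :
  (forall a, flip (D a) * r = r * D a) ->
  leg213 (Delta_id D x) * leg12 r = leg12 r * Delta_id D x.
Proof.
move=> Dr; have tassocE (y : A ⊗ A) b : tassoc (y ⊗ b) = leg12 y * (1 ⊗ 1 ⊗ b).
  tensor_elim y => a c.
  by rewrite tassoc_pure leg12_pure !pureM !mulr1 mul1r.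
have leg213_leg12 (y : A ⊗ A) : leg213 (leg12 y) = leg12 (flip y).
  by tensor_elim y => a b; rewrite leg12_pure leg213_pure flip_pure leg12_pure.
have commr (b : A) s : (1 ⊗ 1 ⊗ b) * leg12 s = leg12 s * (1 ⊗ 1 ⊗ b).
  tensor_elim s => a c.
  by rewrite leg12_pure !pureM !mulr1 !mul1r.
tensor_elim x => a b.
rewrite Delta_id_pure tassocE rmorphM /= leg213_leg12 leg213_pure.
by rewrite -mulrA commr !mulrA -!rmorphM Dr.
Qed.

(** Mirror image of [leg213_Delta_id], in the last two slots; it gives the Yang-Baxter equation in
    (2). *)
Lemma leg132_id_Delta (x r : A ⊗ A) :
  (forall a, flip (D a) * r = r * D a) ->
  leg132 (id_Delta D x) * leg23 r = leg23 r * id_Delta D x.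
Proof.
move=> Dr; have leg132_flip a (y : A ⊗ A) : leg132 (a ⊗ y) = a ⊗ flip y.
  by tensor_elim y => b c; rewrite leg132_pure flip_pure.
tensor_elim x => a b.
by rewrite id_Delta_pure leg132_flip leg23E !pureM mul1r mulr1 Dr.
Qed.

End CoproductMaps.

(** * The counit applied in one slot, as an algebra morphism *)

Section CounitMaps.
Context {k : fieldType}.
Variables (A : algType k) (e : {lrmorphism A -> k^o}).

Lemma eps_id_bilin (V : lmodType k) : bilin (fun (a : A) (v : V) => e a *: v).
Proof.
split=> [v|a] c x y /=; last by rewrite scalerDr !scalerA mulrC.
by rewrite linearP scalerDl scalerA.
Qed.

Lemma id_eps_bilin : bilin (fun a b : A => e b *: a).
Proof.
split=> [v|a] c x y /=; first by rewrite scalerDr !scalerA mulrC.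
by rewrite linearP scalerDl scalerA.
Qed.

Lemma eps_id_pure (V : lmodType k) (a : A) (v : V) :
  eps_id e (a ⊗ v) = e a *: v.
Proof. exact: tlift_pure (eps_id_bilin V) a v. Qed.

Lemma id_eps_pure (a b : A) : id_eps e (a ⊗ b) = e b *: a.
Proof. exact: tlift_pure id_eps_bilin a b. Qed.

HB.instance Definition _ (V : lmodType k) := GRing.isLinear.Build k
  (A ⊗ V)%type V *:%R (@eps_id k A e V) (tlift_linear (eps_id_bilin V)).

HB.instance Definition _ := GRing.isLinear.Build k
  (A ⊗ A)%type A *:%R (id_eps e) (tlift_linear id_eps_bilin).

Lemma eps_id_monoid_morphism (B : algType k) :
  monoid_morphism (@eps_id k A e B).
Proof.
apply: tensor_monoid_morphism => /= [|a b c d].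
  by rewrite eps_id_pure rmorph1 scale1r.
by rewrite pureM !eps_id_pure rmorphM -scalerAl -scalerAr scalerA.
Qed.

Lemma id_eps_monoid_morphism : monoid_morphism (id_eps e).
Proof.
apply: tensor_monoid_morphism => /= [|a b c d].
  by rewrite id_eps_pure rmorph1 scale1r.
by rewrite pureM !id_eps_pure rmorphM -scalerAl -scalerAr scalerA mulrC.
Qed.

HB.instance Definition _ (B : algType k) := GRing.isMonoidMorphism.Build
  (A ⊗ B)%type B (@eps_id k A e B) (eps_id_monoid_morphism B).

HB.instance Definition _ := GRing.isMonoidMorphism.Build
  (A ⊗ A)%type A (id_eps e) id_eps_monoid_morphism.

Lemma tmap_id_monoid_morphism (B C : algType k) (f : {lrmorphism B -> C}) :
  monoid_morphism (tmap (idfun : {linear A -> A}) f).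
Proof.
apply: (@tensor_monoid_morphism k A B (A ⊗ C)%type
  (tmap (idfun : {linear A -> A}) f)) => /= [|a b c d].
  by rewrite -pure11 (tmap_pure idfun) !rmorph1.
by rewrite pureM !(tmap_pure idfun) pureM !rmorphM.
Qed.

Definition id_id_eps : A ⊗ A ⊗ A -> A ⊗ A := tmap idfun (id_eps e).

Lemma id_id_eps_pure (a : A) (x : (A ⊗ A)%type) :
  id_id_eps (a ⊗ x) = a ⊗ id_eps e x.
Proof. exact: (tmap_pure idfun (id_eps e)). Qed.

Lemma id_eps_id_pure (a : A) (x : (A ⊗ A)%type) :
  id_eps_id e (a ⊗ x) = a ⊗ eps_id e x.
Proof. exact: (tmap_pure idfun (@eps_id k A e A)). Qed.

HB.instance Definition _ := GRing.isLinear.Build k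
  (A ⊗ A ⊗ A)%type (A ⊗ A)%type *:%R id_id_eps
  (linearP (tmap (idfun : {linear A -> A}) (id_eps e))).

HB.instance Definition _ := GRing.isMonoidMorphism.Build
  (A ⊗ A ⊗ A)%type (A ⊗ A)%type id_id_eps
  (tmap_id_monoid_morphism (id_eps e)).

HB.instance Definition _ := GRing.isLinear.Build k
  (A ⊗ A ⊗ A)%type (A ⊗ A)%type *:%R (id_eps_id e)
  (linearP (tmap (idfun : {linear A -> A}) (@eps_id k A e A))).

HB.instance Definition _ := GRing.isMonoidMorphism.Build
  (A ⊗ A ⊗ A)%type (A ⊗ A)%type (id_eps_id e)
  (tmap_id_monoid_morphism (@eps_id k A e A)).

(** Products associate to the right, so the counit of slot 4 has to be taken inside the second
    factor, before that of slot 3. On the left, two plain applications of [eps_id] do the same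
    job. *)
Definition id_id_eps_eps : A ⊗ A ⊗ A ⊗ A -> A ⊗ A :=
  fun x => id_id_eps (tmap idfun id_id_eps x).

Lemma id_id_eps_eps_pure (a : A) (x : (A ⊗ A ⊗ A)%type) :
  id_id_eps_eps (a ⊗ x) = a ⊗ id_eps e (id_id_eps x).
Proof.
by rewrite /id_id_eps_eps (tmap_pure idfun id_id_eps) id_id_eps_pure.
Qed.

Lemma id_id_eps_eps_linear : linear id_id_eps_eps.
Proof.
move=> c x y; rewrite /id_id_eps_eps.
by rewrite (linearP (tmap (idfun : {linear A -> A}) id_id_eps)) linearP.
Qed.

HB.instance Definition _ := GRing.isLinear.Build k
  (A ⊗ A ⊗ A ⊗ A)%type (A ⊗ A)%type *:%R id_id_eps_eps id_id_eps_eps_linear.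

Lemma id_id_eps_eps_monoid_morphism : monoid_morphism id_id_eps_eps.
Proof.
have [f1 fM] := tmap_id_monoid_morphism id_id_eps.
by split=> [|x y]; rewrite /id_id_eps_eps ?f1 ?fM ?rmorph1 ?rmorphM.
Qed.

HB.instance Definition _ := GRing.isMonoidMorphism.Build
  (A ⊗ A ⊗ A ⊗ A)%type (A ⊗ A)%type id_id_eps_eps
  id_id_eps_eps_monoid_morphism.

Lemma eps_id_leg13 (x : A ⊗ A) : eps_id e (leg13 x) = 1 ⊗ eps_id e x.
Proof.
by tensor_elim x => a b; rewrite leg13_pure !eps_id_pure pureZr.
Qed.
Lemma eps_id_leg23 (x : A ⊗ A) : eps_id e (leg23 x) = x.
Proof. by rewrite leg23E eps_id_pure rmorph1 scale1r. Qed.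
Lemma eps_id_leg132 (x : A ⊗ A ⊗ A) :
  eps_id e (leg132 x) = flip (eps_id e x).
Proof.
tensor_elim x => a x; tensor_elim x => b c.
by rewrite leg132_pure !eps_id_pure linearZ /= flip_pure.
Qed.
(** Slot 1 of [leg312 x] holds the middle leg of [x], so for the associator the triangle axiom
    evaluates the result. The same happens in slot 3 of [leg231 x]. *)
Lemma eps_id_leg312 (x : A ⊗ A ⊗ A) :
  eps_id e (leg312 x) = flip (id_eps_id e x).
Proof.
tensor_elim x => a x; tensor_elim x => b c.
by rewrite leg312_pure id_eps_id_pure !eps_id_pure flip_pure pureZl.
Qed.

Lemma id_eps_id_leg12 (x : A ⊗ A) : id_eps_id e (leg12 x) = id_eps e x ⊗ 1.
Proof.
tensor_elim x => a b.
by rewrite leg12_pure id_eps_id_pure eps_id_pure id_eps_pure pureZl pureZr.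
Qed.
Lemma id_eps_id_leg13 (x : A ⊗ A) : id_eps_id e (leg13 x) = x.
Proof.
tensor_elim x => a b.
by rewrite leg13_pure id_eps_id_pure eps_id_pure rmorph1 scale1r.
Qed.
Lemma id_eps_id_leg23 (x : A ⊗ A) : id_eps_id e (leg23 x) = 1 ⊗ eps_id e x.
Proof. by rewrite leg23E id_eps_id_pure. Qed.

Lemma id_id_eps_leg12 (x : A ⊗ A) : id_id_eps (leg12 x) = x.
Proof.
tensor_elim x => a b.
by rewrite leg12_pure id_id_eps_pure id_eps_pure rmorph1 scale1r.
Qed.
Lemma id_id_eps_leg13 (x : A ⊗ A) : id_id_eps (leg13 x) = id_eps e x ⊗ 1.
Proof.
tensor_elim x => a b.
by rewrite leg13_pure id_id_eps_pure !id_eps_pure pureZl pureZr.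
Qed.
Lemma id_id_eps_leg213 (x : A ⊗ A ⊗ A) :
  id_id_eps (leg213 x) = flip (id_id_eps x).
Proof.
tensor_elim x => a x; tensor_elim x => b c.
by rewrite leg213_pure !id_id_eps_pure !id_eps_pure flip_pure pureZl pureZr.
Qed.
Lemma id_id_eps_leg231 (x : A ⊗ A ⊗ A) :
  id_id_eps (leg231 x) = flip (id_eps_id e x).
Proof.
tensor_elim x => a x; tensor_elim x => b c.
rewrite leg231_pure id_id_eps_pure id_eps_id_pure id_eps_pure eps_id_pure.
by rewrite flip_pure pureZl pureZr.
Qed.

End CounitMaps.

Lemma pure_unit (k : fieldType) (A B : unitAlgType k) (a : A) (b : B) :
  a \is a GRing.unit -> b \is a GRing.unit ->
  (a ⊗ b : A ⊗ B) \is a GRing.unit.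
Proof.
move=> aU bU; apply/unitrP; exists (a^-1 ⊗ b^-1).
by rewrite !pureM !mulVr // !mulrV.
Qed.

(** * Counits of coproducts and of the associator in a quasi-bialgebra *)

Section QuasiBialgebra.
Context {k : fieldType}.
Variables (A : unitAlgType k) (Delta : {lrmorphism A -> A ⊗ A}).
Variables (eps : {lrmorphism A -> k^o}) (Phi : A ⊗ A ⊗ A) (cr cl : A).
Hypothesis HQ : quasi_bialgebra Delta eps Phi cr cl.
Hypotheses (Hcl : eps cl = 1) (Hcr : eps cr = 1).

Let clU : cl \is a GRing.unit := qb_cl_unit HQ.
Let crU : cr \is a GRing.unit := qb_cr_unit HQ.
Let PhiU : Phi \is a GRing.unit := qb_Phi_unit HQ.

Lemma eps_id_Delta_id (B : algType k) (x : A ⊗ B) :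
  eps_id eps (Delta_id Delta x) = (cl^-1 ⊗ 1) * x * (cl ⊗ 1).
Proof.
have epsE (y : A ⊗ A) (b : B) :
    eps_id eps (tassoc (y ⊗ b)) = eps_id eps y ⊗ b.
  by tensor_elim y => a c; rewrite tassoc_pure !eps_id_pure pureZl.
tensor_elim x => a b.
by rewrite Delta_id_pure epsE (qb_counitl HQ) !pureM mul1r mulr1.
Qed.

Lemma id_eps_id_Delta_id (x : A ⊗ A) :
  id_eps_id eps (Delta_id Delta x) = (cr^-1 ⊗ 1) * x * (cr ⊗ 1).
Proof.
have epsE (y : A ⊗ A) (b : A) :
    id_eps_id eps (tassoc (y ⊗ b)) = id_eps eps y ⊗ b.
  tensor_elim y => a c.
  by rewrite tassoc_pure id_eps_id_pure eps_id_pure id_eps_pure pureZlr.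
tensor_elim x => a b.
by rewrite Delta_id_pure epsE (qb_counitr HQ) !pureM mul1r mulr1.
Qed.

Lemma id_eps_id_id_Delta (x : A ⊗ A) :
  id_eps_id eps (id_Delta Delta x) = (1 ⊗ cl^-1) * x * (1 ⊗ cl).
Proof.
tensor_elim x => a b.
by rewrite id_Delta_pure id_eps_id_pure (qb_counitl HQ) !pureM mul1r mulr1.
Qed.

Lemma id_id_eps_id_Delta (x : A ⊗ A) :
  id_id_eps eps (id_Delta Delta x) = (1 ⊗ cr^-1) * x * (1 ⊗ cr).
Proof.
tensor_elim x => a b.
by rewrite id_Delta_pure id_id_eps_pure (qb_counitr HQ) !pureM mul1r mulr1.
Qed.

(** The counits of slots 1 and 2 may be taken in either order. With slot 2 first, the triangle axiom
    applies and [eps cr = 1] removes the other constraint. *)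
Lemma eps_eps_id_Phi : eps_id eps (eps_id eps Phi) = cl^-1.
Proof.
have -> : eps_id eps (eps_id eps Phi) = eps_id eps (id_eps_id eps Phi).
  move: Phi => x; tensor_elim x => a x; tensor_elim x => b c.
  by rewrite id_eps_id_pure !eps_id_pure linearZ /= eps_id_pure.
by rewrite (qb_triangle HQ) eps_id_pure Hcr scale1r.
Qed.

Lemma id_eps_eps_Phi : id_eps eps (id_id_eps eps Phi) = cr.
Proof.
have -> : id_eps eps (id_id_eps eps Phi) = id_eps eps (id_eps_id eps Phi).
  move: Phi => x; tensor_elim x => a x; tensor_elim x => b c.
  rewrite id_eps_id_pure id_id_eps_pure eps_id_pure !id_eps_pure.
  rewrite !linearZ /=; congr (_ *: _); exact: mulrC.
by rewrite (qb_triangle HQ) id_eps_pure rmorphV //= Hcl invr1 scale1r.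
Qed.

(* Apply the counit in the first two slots of the pentagon. *)
Lemma eps_id_id_Phi : eps_id eps Phi = Delta cl^-1 * (cl ⊗ 1).
Proof.
have epseps_id_id_Delta (x : A ⊗ A ⊗ A) :
    eps_id eps (eps_id eps (id_id_Delta Delta x))
    = Delta (eps_id eps (eps_id eps x)).
  tensor_elim x => a x; tensor_elim x => b c.
  rewrite id_id_Delta_pure id_Delta_pure !eps_id_pure !linearZ /=.
  by rewrite !eps_id_pure !linearZ.
(* Both counits fall on the two halves of one coproduct; conjugation by [cl] is invisible to
   [eps]. *)
have epseps_Delta_id_id (x : A ⊗ A ⊗ A) :
    eps_id eps (eps_id eps (Delta_id_id Delta x)) = eps_id eps x.
  have epsE (y : A ⊗ A) (v : (A ⊗ A)%type) :
      eps_id eps (eps_id eps (tassoc (y ⊗ v))) = (eps (eps_id eps y) : k) *: v.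
    tensor_elim y => a c.
    by rewrite tassoc_pure !eps_id_pure !linearZ /= eps_id_pure scalerA.
  rewrite /Delta_id_id; tensor_elim x => a x.
  rewrite Delta_id_pure epsE eps_id_pure (qb_counitl HQ).
  by rewrite !rmorphM rmorphV //= Hcl invr1 mul1r mulr1.
have eps_id_Delta_id_id (x : A ⊗ A ⊗ A) :
    eps_id eps (id_Delta_id Delta x) = Delta_id Delta (eps_id eps x).
  tensor_elim x => a x.
  by rewrite id_Delta_id_pure !eps_id_pure linearZ.
have epseps_tensor_one (x : A ⊗ A ⊗ A) :
    eps_id eps (eps_id eps (tensor_one x)) = eps_id eps (eps_id eps x) ⊗ 1.
  tensor_elim x => a x; tensor_elim x => b c.
  by rewrite tensor_one_pure !eps_id_pure !linearZ /= !eps_id_pure !pureZl.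
have := congr1 (fun x => eps_id eps (eps_id eps x)) (qb_pentagon HQ).
rewrite /= !rmorphM /= epseps_id_id_Delta epseps_Delta_id_id.
rewrite epseps_tensor_one eps_id_Delta_id_id eps_id_Delta_id eps_eps_id_Phi.
rewrite eps_id_pure rmorph1 scale1r.
have EU : eps_id eps Phi \is a GRing.unit by exact: rmorph_unit.
have clV : (cl ⊗ 1) * (cl^-1 ⊗ 1) = 1 :> A ⊗ A by rewrite pureM divrr // mulr1.
have clV' : (cl^-1 ⊗ 1) * (cl ⊗ 1) = 1 :> A ⊗ A by rewrite pureM mulVr // mulr1.
(* With [E] for [eps_id eps Phi], the pentagon now reads [Delta cl^-1 * E = E * (cl^-1 ⊗ 1) * E],
   and the right factor [E] cancels. *)
rewrite -!mulrA clV mulr1 !mulrA => /(mulIr EU) ->.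
by rewrite -mulrA clV' mulr1.
Qed.

(* Apply the counit in the last two slots of the pentagon. *)
Lemma id_id_eps_Phi : id_id_eps eps Phi = (1 ⊗ cr^-1) * Delta cr.
Proof.
have epseps_id_id_Delta (x : A ⊗ A ⊗ A) :
    id_id_eps_eps eps (id_id_Delta Delta x) = id_id_eps eps x.
  have epsE (y : A ⊗ A) :
      id_eps eps (id_id_eps eps (id_Delta Delta y)) = id_eps eps y.
    rewrite id_id_eps_id_Delta !rmorphM /= !id_eps_pure rmorphV //= Hcr invr1.
    by rewrite !scale1r mul1r mulr1.
  tensor_elim x => a x.
  by rewrite id_id_Delta_pure id_id_eps_eps_pure epsE id_id_eps_pure.
have epseps_Delta_id_id (x : A ⊗ A ⊗ A) :
    id_id_eps_eps eps (Delta_id_id Delta x)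
    = Delta (id_eps eps (id_id_eps eps x)).
  have epsE (y : A ⊗ A) b c :
      id_id_eps_eps eps (tassoc (y ⊗ b ⊗ c)) = (eps c * eps b : k) *: y.
    tensor_elim y => a d.
    rewrite tassoc_pure id_id_eps_eps_pure id_id_eps_pure !id_eps_pure.
    by rewrite linearZ pureZr.
  rewrite /Delta_id_id; tensor_elim x => a x; tensor_elim x => b c.
  by rewrite Delta_id_pure epsE id_id_eps_pure !id_eps_pure !linearZ.
(* The counit of slot 3 meets the second half of the coproduct of the middle leg, whence the
   conjugation by [cr]. *)
have epseps_id_Delta_id (x : A ⊗ A ⊗ A) :
    id_id_eps_eps eps (id_Delta_id Delta x)
    = (1 ⊗ cr^-1) * id_id_eps eps x * (1 ⊗ cr).
  have epsE (y : A ⊗ A) c :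
      id_eps eps (id_id_eps eps (tassoc (y ⊗ c))) = (eps c : k) *: id_eps eps y.
    tensor_elim y => a b.
    by rewrite tassoc_pure id_id_eps_pure !id_eps_pure linearZ scalerA.
  tensor_elim x => a x; tensor_elim x => b c.
  rewrite id_Delta_id_pure id_id_eps_eps_pure Delta_id_pure epsE.
  rewrite (qb_counitr HQ) id_id_eps_pure id_eps_pure !pureM mul1r mulr1.
  by rewrite -scalerAr -scalerAl.
have epseps_tensor_one (x : A ⊗ A ⊗ A) :
    id_id_eps_eps eps (tensor_one x) = id_id_eps eps x.
  tensor_elim x => a x; tensor_elim x => b c.
  rewrite tensor_one_pure id_id_eps_eps_pure !id_id_eps_pure !id_eps_pure.
  by rewrite rmorph1 scale1r.
have := congr1 (id_id_eps_eps eps) (qb_pentagon HQ).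
rewrite !rmorphM /= epseps_id_id_Delta epseps_Delta_id_id.
rewrite epseps_tensor_one epseps_id_Delta_id id_eps_eps_Phi.
rewrite id_id_eps_eps_pure id_eps_eps_Phi.
have GU : id_id_eps eps Phi \is a GRing.unit by exact: rmorph_unit.
have crV : (1 ⊗ cr) * (1 ⊗ cr^-1) = 1 :> A ⊗ A by rewrite pureM divrr // mulr1.
have crV' : (1 ⊗ cr^-1) * (1 ⊗ cr) = 1 :> A ⊗ A by rewrite pureM mulVr // mulr1.
(* With [G] for [id_id_eps eps Phi], the pentagon now reads [G * Delta cr = G * (1 ⊗ cr) * G], and
   the left factor [G] cancels. *)
rewrite !mulrA crV mul1r -!mulrA => /(mulrI GU) ->.
by rewrite mulrA crV' mul1r.
Qed.

End QuasiBialgebra.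

(** * Yang-Baxter equation and counits of the R-matrix under either intertwining hypothesis *)

Unset Implicit Arguments.

Theorem proposition1p5 (k : fieldType) (A : unitAlgType k)
    (Delta : {lrmorphism A -> A ⊗ A}) (eps : {lrmorphism A -> k^o})
    (Phi : A ⊗ A ⊗ A) (cr cl : A) (R : A ⊗ A)
    (HQT : quasi_triangular Delta eps Phi cr cl R)
    (Hcl : eps cl = 1) (Hcr : eps cr = 1) :
  (leg213 Phi * leg12 R = leg12 R * leg123 Phi ->
    [/\ id_Delta Delta R = (leg231 Phi)^-1 * leg13 R * leg12 R,
        Delta_id Delta R = leg13 R * leg23 R * leg123 Phi,
        leg12 R * leg13 R * leg23 R = leg23 R * leg13 R * leg12 R
      & [/\ eps_id eps R = cl, id_eps eps R = cl^-1 & cr = 1]])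
  /\
  (leg132 Phi * leg23 R = leg23 R * leg123 Phi ->
    [/\ id_Delta Delta R = leg13 R * leg12 R * (leg123 Phi)^-1,
        Delta_id Delta R = leg312 Phi * leg13 R * leg23 R,
        leg12 R * leg13 R * leg23 R = leg23 R * leg13 R * leg12 R
      & [/\ eps_id eps R = cr^-1, id_eps eps R = cr & cl = 1]]).
Proof.
case: HQT; rewrite /leg123 => HQ RU Rcomm RDr RDl.
have PhiU := qb_Phi_unit HQ.
have clU := qb_cl_unit HQ; have crU := qb_cr_unit HQ.
have qU : eps_id eps R \is a GRing.unit by exact: rmorph_unit.
have pU : id_eps eps R \is a GRing.unit by exact: rmorph_unit.
split=> H.
  have H' : leg312 Phi * leg13 R = leg13 R * leg132 Phi.
    by rewrite -leg132_leg213 -leg132_leg12 -!rmorphM H.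
  have idDR : id_Delta Delta R = (leg231 Phi)^-1 * leg13 R * leg12 R.
    by rewrite RDr -[_ * leg213 Phi * _]mulrA H !mulrA mulrK.
  have DidR : Delta_id Delta R = leg13 R * leg23 R * Phi.
    by rewrite RDl H' mulrK //; exact: rmorph_unit.
  have cr1 : cr = 1.
    have := congr1 (id_id_eps eps) H.
    rewrite !rmorphM /= id_id_eps_leg213 id_id_eps_leg12.
    rewrite (id_id_eps_Phi HQ Hcl Hcr) (rmorphM (@flip k A)) /= flip_pure.
    (* [Rcomm] carries [R] past [flip (Delta cr)], so both sides end in the unit [Delta cr], which
       cancels next. *)
    rewrite -mulrA Rcomm !mulrA => e1.
    have := congr1 (eps_id eps) (mulIr (rmorph_unit Delta crU) e1).
    rewrite !rmorphM /= !eps_id_pure rmorphV //= Hcr rmorph1 invr1 !scale1r.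
    (* What remains is [eps_id eps R = eps_id eps R * cr^-1], with [eps_id eps R] a unit. *)
    rewrite mul1r -{1}[eps_id eps R]mulr1 => /(mulrI qU) /esym.
    by move=> /(congr1 GRing.inv); rewrite invrK invr1.
  split=> //.
    (* By [DidR] this reads [R_23 R_13 Phi_213 R_12 = R_12 R_13 R_23 Phi]; [H] moves the associator
       on the left to the end. *)
    have := leg213_Delta_id R Rcomm.
    rewrite DidR !rmorphM /= leg213_leg13 leg213_leg23.
    by rewrite -[_ * leg213 Phi * _]mulrA H !mulrA => /(mulIr PhiU) ->.
  split=> //.
    (* Since [cr = 1], the middle counit gives [R = R * (1 ⊗ eps_id eps R * cl^-1)]. *)
    have := congr1 (id_eps_id eps) DidR.
    rewrite (id_eps_id_Delta_id HQ) cr1 invr1 mul1r mulr1 !rmorphM /=.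
    rewrite id_eps_id_leg13 id_eps_id_leg23 (qb_triangle HQ) cr1 -mulrA pureM.
    rewrite mulr1 -{1}[R]mulr1 => /(mulrI RU) /(congr1 (eps_id eps)).
    rewrite rmorph1 eps_id_pure rmorph1 scale1r => e1.
    by rewrite -[LHS](mulrVK clU) -e1 mul1r.
  (* The counit goes to slot 3, which holds the middle leg in [leg231 Phi]. The outcome is [R =
     (cl^-1 ⊗ 1)^-1 * (id_eps eps R ⊗ 1) * R]. *)
  have := congr1 (id_id_eps eps) idDR.
  rewrite (id_id_eps_id_Delta HQ) cr1 invr1 mul1r mulr1 !rmorphM /=.
  rewrite rmorphV /=; last exact: rmorph_unit.
  rewrite id_id_eps_leg231 id_id_eps_leg13 id_id_eps_leg12 (qb_triangle HQ).
  rewrite cr1 flip_pure -{1}[R]mul1r => /(mulIr RU) e1.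
  have cVU : (cl^-1 ⊗ 1 : A ⊗ A) \is a GRing.unit.
    by rewrite pure_unit ?unitrV ?unitr1.
  have := congr1 (id_eps eps) (mulVKr cVU (id_eps eps R ⊗ 1)).
  by rewrite -e1 mulr1 !id_eps_pure rmorph1 !scale1r => ->.
(* Mirror case: here the swap of slots 1 and 2 moves the hypothesis, and [HV] below is its form for
   the inverse associator in the second hexagon. *)
have H' : leg231 Phi * leg13 R = leg13 R * leg213 Phi.
  by rewrite -leg213_leg132 -leg213_leg23 -!rmorphM H.
have HV : (leg132 Phi)^-1 * leg23 R = leg23 R * Phi^-1.
  apply: (mulIr PhiU); rewrite divrK // -mulrA -H mulKr //.
  exact: rmorph_unit.
have idDR : id_Delta Delta R = leg13 R * leg12 R * Phi^-1.
  rewrite RDr -[_^-1 * _ * _]mulrA -H' mulKr //; exact: rmorph_unit.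
have DidR : Delta_id Delta R = leg312 Phi * leg13 R * leg23 R.
  by rewrite RDl -[_ * _^-1 * _]mulrA HV !mulrA divrK.
have cl1 : cl = 1.
  have := congr1 (eps_id eps) H.
  rewrite !rmorphM /= eps_id_leg132 eps_id_leg23.
  rewrite (eps_id_id_Phi HQ Hcl Hcr) (rmorphM (@flip k A)) /= flip_pure.
  (* Now both sides begin with [flip (Delta cl^-1)]; cancelling it leaves
     [(1 ⊗ cl) * R = R * (cl ⊗ 1)]. *)
  rewrite [R * (_ * _)]mulrA -Rcomm -!mulrA => e1.
  have DU : flip (Delta cl^-1) \is a GRing.unit.
    by apply: rmorph_unit; apply: rmorph_unit; rewrite unitrV.
  have := congr1 (id_eps eps) (mulrI DU e1).
  rewrite !rmorphM /= !id_eps_pure Hcl rmorph1 !scale1r.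
  by rewrite mul1r -{1}[id_eps eps R]mulr1 => /(mulrI pU).
split=> //.
  (* By [idDR] and [HV] this becomes the Yang-Baxter equation times [Phi^-1] on the right. *)
  have := leg132_id_Delta R Rcomm.
  rewrite idDR !rmorphM /= rmorphV //= leg132_leg13 leg132_leg12.
  rewrite -[_ * _^-1 * _]mulrA HV !mulrA => e1.
  have PhiVU : Phi^-1 \is a GRing.unit by rewrite unitrV.
  exact: (mulIr PhiVU e1).
split=> //.
  (* Since [cl = 1], the result is [R = (1 ⊗ cr * eps_id eps R) * R]. *)
  have := congr1 (eps_id eps) DidR.
  rewrite (eps_id_Delta_id HQ) cl1 invr1 mul1r mulr1 !rmorphM /=.
  rewrite eps_id_leg312 eps_id_leg13 eps_id_leg23 (qb_triangle HQ) cl1 invr1.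
  rewrite flip_pure -{1}[R]mul1r => /(mulIr RU).
  rewrite pureM mulr1 => /(congr1 (eps_id eps)).
  rewrite rmorph1 eps_id_pure rmorph1 scale1r => e1.
  by rewrite -[LHS](mulKr crU) -e1 mulr1.
(* Since [cl = 1], the result is [R = R * (id_eps eps R ⊗ 1) * (cr ⊗ 1)^-1]. *)
have := congr1 (id_eps_id eps) idDR.
rewrite (id_eps_id_id_Delta HQ) cl1 invr1 mul1r mulr1 !rmorphM /= rmorphV //=.
rewrite id_eps_id_leg13 id_eps_id_leg12 (qb_triangle HQ) cl1 invr1.
rewrite -mulrA -{1}[R]mulr1 => /(mulrI RU) e1.
have cU : (cr ⊗ 1 : A ⊗ A) \is a GRing.unit by rewrite pure_unit ?unitr1.
have := congr1 (id_eps eps) (divrK cU (id_eps eps R ⊗ 1)).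
by rewrite -e1 mul1r !id_eps_pure rmorph1 !scale1r => ->.
Qed.
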